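(* One has $[b(1)]=[1]$, $[b(2),b(3)]=[1,2]$, $[b(4),b(5),b(6),b(7)]=[1,2,2,3]$, and for every integer $m\ge 4$, as an equality of vectors of length $t_{m-1}$, $$[b(k_{m+3}-1),\dots,b(k_{m+4}-2)]=[b(k_{m}-1),\dots,b(k_{m+1}-2),\,b(k_{m+1}-1),\dots,b(k_{m+2}-2),\,b(k_{m+2}-1),\dots,b(k_{m+3}-2)]+[\underbrace{1,\dots,1}_{t_{m-1}}].$$
   Context: The Tribonacci sequence $\mathbb{T}$ is the infinite word over $\{a,b,c\}$ that is the fixed point beginning with $a$ of the morphism $\tau(a)=ab$, $\tau(b)=ac$, $\tau(c)=a$; positions are numbered from $1$, and $\mathbb{T}[1,n]$ is its prefix of length $n$. The numbers $t_m$ are given by $t_{-2}=0$, $t_{-1}=t_0=1$, $t_m=t_{m-1}+t_{m-2}+t_{m-3}$ for $m\ge 1$. The kernel numbers are $k_0=0$, $k_1=k_2=1$, $k_m=k_{m-1}+k_{m-2}+k_{m-3}-1$ for $m\ge 3$. $\mathcal{P}_T$ is the set of nonempty palindromes occurring as factors (finite contiguous subwords) of $\mathbb{T}$. For a factor $\omega$ and $p\ge1$, $\omega_p$ denotes the $p$-th occurrence of $\omega$ in $\mathbb{T}$. For $n\ge1$, $b(n)$ is the number of pairs $(\omega,p)$ with $\omega\in\mathcal{P}_T$, $p\ge1$, such that $\omega_p$ is a suffix of $\mathbb{T}[1,n]$, i.e. the $p$-th occurrence of $\omega$ ends exactly at position $n$. *)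

(* Defs.v *)
From HB Require Import structures.
From mathcomp Require Import all_boot.
From mathcomp Require Import finmap.
From mathcomp Require Import boolp classical_sets functions cardinality.

Set Implicit Arguments.
Unset Strict Implicit.
Unset Printing Implicit Defensive.

Local Open Scope classical_set_scope.

Inductive letter := La | Lb | Lc.

Definition letter_code (x : letter) : 'I_3 :=
  match x with La => inord 0 | Lb => inord 1 | Lc => inord 2 end.

Definition letter_decode (i : 'I_3) : letter :=
  match val i with 0 => La | 1 => Lb | _ => Lc end.

Lemma letter_codeK : cancel letter_code letter_decode.
Proof. by case; rewrite /letter_decode /= inordK. Qed.

HB.instance Definition _ := Finite.copy letter (can_type letter_codeK).

(* An infinite word is a function [w : nat -> letter] read at the positions
   1, 2, 3, ...; the value [w 0] is never used. *)

(* The factor of length [l] of [w] starting at position [i]. *)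
Definition subword (w : nat -> letter) (i l : nat) : seq letter :=
  [seq w j | j <- iota i l].

Definition tau (x : letter) : seq letter :=
  match x with
  | La => [:: La; Lb]
  | Lb => [:: La; Lc]
  | Lc => [:: La]
  end.

Definition tau_word (s : seq letter) : seq letter := flatten (map tau s).

(* [tau w = w] for an infinite word [w]: as [tau] is nonerasing, this says that
   the image of every prefix of [w] is again a prefix of [w]. *)
Definition tau_fixed (w : nat -> letter) : Prop :=
  forall n, let u := tau_word (subword w 1 n) in subword w 1 (size u) = u.

(* The limit of the words [tau^n(a)], each of which is a prefix of the next and
   has length greater than [n]. *)
Definition tribonacci (n : nat) : letter :=
  nth La (iter n tau_word [:: La]) n.-1.

Section TribonacciFixedPoint.

Local Notation A n := (iter n tau_word [:: La]).

Lemma tau_word_cat s1 s2 : tau_word (s1 ++ s2) = tau_word s1 ++ tau_word s2.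
Proof. by rewrite /tau_word map_cat flatten_cat. Qed.

Lemma iter_tau_step n : exists2 r, 0 < size r & A n.+1 = A n ++ r.
Proof.
elim: n => [|n [r r0 E]]; first by exists [:: Lb].
exists (tau_word r).
  by move: r0; clear E; case: r => [|[] r].
by rewrite iterS {1}E tau_word_cat -iterS.
Qed.

Lemma iter_tau_prefix m n : m <= n -> prefix (A m) (A n).
Proof.
move=> /subnK <-; elim: (n - m) => [|d IH]; first exact: prefix_refl.
have [r _ E] := iter_tau_step (d + m).
by rewrite addSn E (prefix_trans IH) ?prefix_prefix.
Qed.

Lemma size_iter_tau n : n < size (A n).
Proof.
elim: n => [//|n IH]; have [r r0 ->] := iter_tau_step n.
by rewrite size_cat -addn1 leq_add.
Qed.

Lemma nth_iter_tau m n i : i < size (A m) -> i < size (A n) ->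
  nth La (A m) i = nth La (A n) i.
Proof.
wlog mn : m n / m <= n => [H im i_n|].
  by case: (leqP m n) => [/H|/ltnW/H Hnm]; [exact|rewrite Hnm].
by move=> im _; have /prefixP[r ->] := iter_tau_prefix mn; rewrite nth_cat im.
Qed.

Lemma prefix_tribonacci n k : k <= size (A n) ->
  subword tribonacci 1 k = take k (A n).
Proof.
move=> kn; apply: (@eq_from_nth _ La) => [|i].
  by rewrite size_map size_iota size_takel.
rewrite size_map size_iota => ik.
rewrite (nth_map 0) ?size_iota // nth_iota // nth_take // add1n /tribonacci.
apply: nth_iter_tau; last exact: leq_trans kn.
exact: ltnW (size_iter_tau i.+1).
Qed.

Lemma tribonacci1 : tribonacci 1 = La.
Proof. by []. Qed.

Lemma tribonacci_fixed : tau_fixed tribonacci.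
Proof.
move=> n /=; have nA : n <= size (A n) := ltnW (size_iter_tau n).
rewrite (prefix_tribonacci nA).
have E : A n.+1 = tau_word (take n (A n)) ++ tau_word (drop n (A n)).
  by rewrite -tau_word_cat cat_take_drop.
rewrite (@prefix_tribonacci n.+1); first by rewrite E take_size_cat.
by rewrite E size_cat leq_addr.
Qed.

Lemma tribonacci_unique (w : nat -> letter) :
  w 1 = La -> tau_fixed w -> forall i, 0 < i -> w i = tribonacci i.
Proof.
move=> w1 wfix.
have wA n : subword w 1 (size (A n)) = A n.
  elim: n => [|n IH]; first by rewrite /subword /= w1.
  by have := wfix (size (A n)); rewrite /= IH.
case=> // i _; have iA : i < size (A i.+1) := ltnW (size_iter_tau i.+1).
rewrite /tribonacci -[in RHS](wA i.+1) (nth_map 0) ?size_iota //.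
by rewrite nth_iota.
Qed.

End TribonacciFixedPoint.

(* [t2 n] is t_(n-2), so that the sequence starts at t_(-2); in particular
   [t2 (m + 1)] is t_(m-1). *)
Fixpoint t2 (n : nat) : nat :=
  match n with
  | 0 => 0
  | 1 => 1
  | 2 => 1
  | (((n1.+1 as n2).+1) as n3).+1 => t2 n3 + t2 n2 + t2 n1
  end.

(* The sum of three consecutive kernel numbers is at least 1, so the truncated
   subtraction is exact. *)
Fixpoint kernel_number (m : nat) : nat :=
  match m with
  | 0 => 0
  | 1 => 1
  | 2 => 1
  | (((m1.+1 as m2).+1) as m3).+1 =>
      kernel_number m3 + kernel_number m2 + kernel_number m1 - 1
  end.

Definition occurs_at (s : seq letter) (i : nat) : bool :=
  (0 < i) && (subword tribonacci i (size s) == s).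

Definition factor (s : seq letter) : Prop := exists i, occurs_at s i.

Definition palindromic_factors : set (seq letter) :=
  [set s | [/\ s <> [::], rev s = s & factor s]].

(* The [p]-th occurrence of [s] (counted from 1) starts at position [i]. *)
Definition occurrence (s : seq letter) (p i : nat) : Prop :=
  occurs_at s i /\ count (occurs_at s) (iota 1 i) = p.

(* The [p]-th occurrence of [s] ends at position [n]. *)
Definition occurrence_ends (s : seq letter) (p n : nat) : Prop :=
  exists2 i, occurrence s p i & i + size s = n.+1.

Definition palindrome_occurrences (n : nat) : set (seq letter * nat) :=
  [set sp | [/\ palindromic_factors sp.1, 1 <= sp.2
              & occurrence_ends sp.1 sp.2 n]].

Lemma finite_palindrome_occurrences n : finite_set (palindrome_occurrences n).
Proof.
pose f i := let s := subword tribonacci i (n.+1 - i) in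
  (s, count (occurs_at s) (iota 1 i)).
apply: (@sub_finite_set _ _ (f @` `I_n.+2)); last first.
  exact/finite_image/finite_II.
move=> [s p] [_ _ /= [i [/andP[i0 /eqP si] <-] E]]; exists i => /=.
  by rewrite ltnS -E leq_addr.
by rewrite /f -E addKn si.
Qed.

(* [fset_set] is the finite set underlying a set proved finite above. *)
Definition b (n : nat) : nat := #|` fset_set (palindrome_occurrences n)|%fset.

(* The vector [b(i), b(i+1), ..., b(j)], both ends included. *)
Definition bvec (i j : nat) : seq nat := [seq b n | n <- index_iota i j.+1].

(* Entrywise sum, used on vectors of equal length only. *)
Definition vadd (u v : seq nat) : seq nat := [seq x.1 + x.2 | x <- zip u v].

(* Main.v *)
Require Import Defs.
From mathcomp Require Import all_boot.
From mathcomp Require Import zify.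
From mathcomp Require finmap classical_sets cardinality.

(** Write [A j = tau^j(a)] ([tau_pow] below) and let [P j] ([central] below)
    be the palindromic prefixes of the Tribonacci word [T], so that
    [P (j+1) = tau (P j) a = A j ++ P j].  As [|P j| = k_(j+4) - 2], the indices
    [n] treated by the recurrence are those with [|P j| < n <= |P (j+1)|], where
    [j = m - 1].  Put [t_j = |A j|].  Since [P (j+1)] has period [t_j], the
    palindromic suffixes of [T[1,n]] of length at most [n - t_j] are those of
    [T[1,n-t_j]].  The central reflection of [P (j+1)] gives one that is longer.
    There is no second one: it would yield a nonzero period smaller than [t_j],
    moving the kernel word [T[t_j,|P j|+1]] to an earlier occurrence, whereas
    desubstitution along [tau] shows that this word has none. *)

Set Implicit Arguments.
Unset Strict Implicit.
Unset Printing Implicit Defensive.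

(* The letters of the Tribonacci word, indexed from 0. *)
Definition trib (n : nat) : letter := tribonacci n.+1.

Definition tau_pow (j : nat) : seq letter := iter j tau_word [:: La].

Fixpoint central (j : nat) : seq letter :=
  if j is j'.+1 then rcons (tau_word (central j')) La else [::].

(* Every letter of index [n] is replaced in [tau T = T] by a block whose first
   letter has index [block n]. *)
Definition block (n : nat) : nat := size (tau_word (mkseq trib n)).

(** * Block structure of [tau T = T] and desubstitution *)

Lemma subword_trib i l :
  subword tribonacci i.+1 l = mkseq (fun k => trib (i + k)) l.
Proof.
rewrite /subword -[i.+1]addn0 iotaDl -map_comp.
by apply: eq_map => k /=; rewrite /trib addSn.
Qed.

Lemma subword1_trib l : subword tribonacci 1 l = mkseq trib l.
Proof. exact: subword_trib. Qed.

Lemma tau_word_rcons s x : tau_word (rcons s x) = tau_word s ++ tau x.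
Proof. by rewrite -cats1 tau_word_cat /tau_word /= cats0. Qed.

Lemma tau_word_mkseq n : tau_word (mkseq trib n) = mkseq trib (block n).
Proof. by have := tribonacci_fixed n; rewrite /= !subword1_trib. Qed.

Lemma blockS n : block n.+1 = block n + size (tau (trib n)).
Proof. by rewrite /block mkseqS tau_word_rcons size_cat. Qed.

Lemma trib_block n i : i < size (tau (trib n)) ->
  trib (block n + i) = nth La (tau (trib n)) i.
Proof.
move=> ilt; have lt : block n + i < block n.+1 by rewrite blockS ltn_add2l.
rewrite -(nth_mkseq La trib lt) -tau_word_mkseq mkseqS tau_word_rcons nth_cat.
by rewrite -/(block n) ltnNge leq_addr /= addKn.
Qed.

Lemma trib_block0 n : trib (block n) = La.
Proof. by rewrite -[block n]addn0 trib_block; case: (trib n). Qed.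

(** Each case records the letter after the block's initial [a]. For [Lc] the block is [a] alone and
    that letter is the [a] opening the next block, so this one letter identifies [trib n]. *)
Variant block_spec n : letter -> nat -> Prop :=
  | BlockA of trib (block n).+1 = Lb : block_spec n La (block n).+2
  | BlockB of trib (block n).+1 = Lc : block_spec n Lb (block n).+2
  | BlockC of trib (block n).+1 = La : block_spec n Lc (block n).+1.

Lemma blockP n : block_spec n (trib n) (block n.+1).
Proof.
have := @trib_block n 1; have := trib_block0 n.+1; rewrite blockS.
case: (trib n) => /=; rewrite ?addn1 ?addn2 => E H; constructor => //;
  exact: H.
Qed.

Lemma block_mono : {mono block : m n / m <= n}.
Proof.
apply: leq_mono; apply: (homo_ltn ltn_trans) => n.
by case: (blockP n) => _ //; rewrite ltnS leqnSn.
Qed.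

Lemma block_cover q :
  exists n, q = block n \/ q = (block n).+1 /\ block n.+1 = (block n).+2.
Proof.
elim: q => [|q [n [->|[-> E]]]]; first by exists 0; left.
  have [E|E] : block n.+1 = (block n).+2 \/ block n.+1 = (block n).+1.
    by case: (blockP n) => _; auto.
    by exists n; right.
  by exists n.+1; left.
by exists n.+1; left.
Qed.

Lemma trib_La_block q : trib q = La -> exists n, q = block n.
Proof.
case: (block_cover q) => n [->|[-> E]]; first by exists n.
case: (blockP n) E => [-> //|-> //|_ E]; lia.
Qed.

Lemma trib_nLa_block q : trib q <> La ->
  exists n, q = (block n).+1 /\ block n.+1 = (block n).+2.
Proof.
case: (block_cover q) => n [->|H _]; first by rewrite trib_block0.
by exists n.
Qed.

Definition agree (p q l : nat) :=
  forall i, i < l -> trib (p + i) = trib (q + i).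

(* The letter following a factor [tau w] shows where its last block ends. *)
Lemma agree_desubst m n r :
  agree (block m) (block n) (block (n + r) - block n).+1 -> agree m n r.
Proof.
elim: r m n => [|r IH] m n H i //.
have n1r : block n.+1 <= block (n + r.+1) by rewrite block_mono; lia.
have n0 : block n < block n.+1 by rewrite ltnNge block_mono -ltnNge.
have h1 : trib (block m).+1 = trib (block n).+1.
  by have := H 1; rewrite !addn1; apply; lia.
have [E B] : trib m = trib n /\ block m.+1 - block m = block n.+1 - block n.
  by move: h1; case: (blockP m) => ->; case: (blockP n) => -> //;
    split=> //; lia.
have m0 : block m < block m.+1 by rewrite ltnNge block_mono -ltnNge.
case: i => [|i]; first by rewrite !addn0.
rewrite ltnS => ir; rewrite -!addSnnS; apply: IH ir => k kr.
rewrite addSnnS in kr.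
have -> : block m.+1 + k = block m + (block n.+1 - block n + k) by lia.
have -> : block n.+1 + k = block n + (block n.+1 - block n + k) by lia.
by apply: H; lia.
Qed.

(** * Lengths and symmetry of [A j] and [P j] *)

Lemma tau_powS j : tau_pow j.+1 = tau_word (tau_pow j).
Proof. by []. Qed.

Lemma size_tau_powSSS j : size (tau_pow j.+3) =
  size (tau_pow j.+2) + size (tau_pow j.+1) + size (tau_pow j).
Proof.
(* The lengths come from the word identity [A (j+3) = A (j+2) A (j+1) A j], which [tau]
   preserves. *)
rewrite -!size_cat; congr size; elim: j => [//|j IH].
by rewrite tau_powS [in LHS]IH !tau_word_cat -!tau_powS.
Qed.

Lemma t2_tau_pow j : t2 j.+2 = size (tau_pow j).
Proof.
suff [] : [/\ t2 j.+2 = size (tau_pow j), t2 j.+3 = size (tau_pow j.+1)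
            & t2 j.+4 = size (tau_pow j.+2)] by [].
elim: j => [//|j [H0 H1 H2]]; split=> //.
by rewrite size_tau_powSSS -H0 -H1 -H2.
Qed.

Lemma size_tau_pow_gt0 j : 0 < size (tau_pow j).
Proof. exact: leq_ltn_trans (size_iter_tau j). Qed.

Lemma tau_pow_trib j : tau_pow j = mkseq trib (size (tau_pow j)).
Proof. by rewrite -subword1_trib (@prefix_tribonacci j) // take_size. Qed.

Lemma centralS j : central j.+1 = tau_pow j ++ central j.
Proof.
elim: j => [//|j IH].
rewrite -[LHS]/(rcons (tau_word (central j.+1)) La).
by rewrite {1}IH tau_word_cat rcons_cat.
Qed.

Lemma size_centralS j :
  size (central j.+1) = size (tau_pow j) + size (central j).
Proof. by rewrite centralS size_cat. Qed.

Lemma central_trib j : central j = mkseq trib (size (central j)).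
Proof.
elim: j => [//|j IH] /=.
by rewrite size_rcons mkseqS {1 2 3}IH tau_word_mkseq size_mkseq trib_block0.
Qed.

Lemma size_central_block j :
  size (central j.+1) = (block (size (central j))).+1.
Proof. by rewrite /= size_rcons /block -central_trib. Qed.

Lemma size_tau_pow_block j : size (tau_pow j.+1) = block (size (tau_pow j)).
Proof. by rewrite /block -tau_pow_trib. Qed.

(** Every block satisfies [a rev (tau x) = tau x a], so the extra [a] travels through the word.
    Hence [tau s a] is a palindrome whenever [s] is. *)
Lemma rev_tau_word s : La :: rev (tau_word s) = rcons (tau_word (rev s)) La.
Proof.
elim: s => [//|x s IH].
rewrite -[x :: s]/([:: x] ++ s) tau_word_cat !rev_cat tau_word_cat rcons_cat.
rewrite -cat_cons IH -cats1 -catA; congr (_ ++ _).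
by case: x.
Qed.

Lemma rev_central j : rev (central j) = central j.
Proof. by elim: j => [//|j IH] /=; rewrite rev_rcons rev_tau_word IH. Qed.

Lemma size_central_sub3 j :
  size (central j.+3) = size (tau_pow j.+3) + size (central j).
Proof. by rewrite !size_centralS size_tau_powSSS; lia. Qed.

(** * First occurrences of kernel words *)

Lemma trib_central_tau_pow j :
  trib (size (central j)) = trib (size (tau_pow j)).-1.
Proof.
(* These are the two end letters of a kernel word. Passing to [j+1] turns a common letter [x] into
   the last letter of [tau x] on both sides; after [P (j+1)], when [x = c], this [a] is the start of
   the next block. *)
elim: j => [//|j]; rewrite size_central_block size_tau_pow_block.
have := size_tau_pow_gt0 j; case: (size (tau_pow j)) => [//|s] _.
rewrite [s.+1.-1]/=.
by case: (blockP s) => E1; case: (blockP (size (central j))) => E2 //;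
  rewrite ?[_.+2.-1]/= ?[_.+1.-1]/= ?E1 ?E2 ?trib_block0.
Qed.

Lemma size_tau_pow_central j : size (tau_pow j) <= (size (central j)).+1.
Proof.
elim: j => [//|j IH]; rewrite size_tau_pow_block size_central_block.
apply: leq_trans (_ : block (size (central j)).+1 <= _).
  by rewrite block_mono.
by case: (blockP (size (central j))) => _; lia.
Qed.

(* The factor at index [|A (j+3)| - 1] is the kernel word [K j].  Since
   [tau (K j) a] is [K (j+1)] or [a K (j+1) a], with the added letters forced,
   a too early occurrence desubstitutes down to one of [K 0 = aa]. *)
Lemma kernel_word_first j q :
  agree q (size (tau_pow j.+3)).-1
    (size (central j.+3) - (size (tau_pow j.+3)).-1).+1 ->
  (size (tau_pow j.+3)).-1 <= q.
Proof.
elim: j q => [|j IH] q H.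
  have /= := H 0 isT; have /= := H 1 isT.
  by move: q {H} => [|[|[|[|[|[|q]]]]]].
move: IH H; have := trib_central_tau_pow j.+3.
have := size_tau_pow_central j.+3.
have := size_tau_pow_gt0 j.+3.
rewrite (size_central_block j.+3) (size_tau_pow_block j.+3).
move: (size (tau_pow j.+3)) (size (central j.+3)) => [//|s] L _.
rewrite ltnS [s.+1.-1]/= => sL ELs IH H.
have sL' : block s <= block L by rewrite block_mono.
have H0 : trib q = trib (block s.+1).-1 by have := H 0 isT; rewrite !addn0.
(* If the end letters of [K j] are [c], their blocks are single letters and [K (j+1) = tau (K j) a].
   Otherwise [K (j+1)] starts and ends with the second letter of a block, and [tau (K j) a] has one
   more [a] on each side. *)
case: (trib s =P Lc) => [Es|Es].
  have [Bs BL] : block s.+1 = (block s).+1 /\ block L.+1 = (block L).+1.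
    by move: ELs Es; case: (blockP s) => // _; case: (blockP L).
  move: H0 H; rewrite Bs [_.+1.-1]/= trib_block0 => /trib_La_block[m ->] H.
  rewrite block_mono; apply: IH; apply: agree_desubst.
  by rewrite addnS subnKC // BL.
have [Bs BL] : block s.+1 = (block s).+2 /\ block L.+1 = (block L).+2.
  by move: ELs Es; case: (blockP s) => // _; case: (blockP L).
move: H0 H; rewrite Bs [_.+2.-1]/= => H0.
have /trib_nLa_block[m [qE Bm]] : trib q <> La.
  by rewrite H0; move: Es; case: (blockP s) => // ->.
rewrite {q}qE in H0 *; move=> H; rewrite ltnS block_mono; apply: IH.
(* Offset 0 is the left added [a], the last offset is the right one, and [H] covers those in
   between. *)
apply: agree_desubst; rewrite addnS subnKC // BL => -[|i] ilt.
  by rewrite !addn0 !trib_block0.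
case: (ltnP i (block L - block s).+1) => iL.
  by rewrite -!addSnnS; apply: H; lia.
have -> : i = (block L - block s).+1 by lia.
have := H (block L - block s).
rewrite addSn [(block s).+1 + _]addSn subnKC // => /(_ ltac:(lia)) EL.
have -> : block s + (block L - block s).+2 = block L.+1 by rewrite BL; lia.
rewrite trib_block0 !addnS.
have /trib_nLa_block[m' [-> {1}<-]] :
    trib (block m + (block L - block s)).+1 <> La.
  by rewrite EL; move: ELs Es => <-; case: (blockP L) => // ->.
exact: trib_block0.
Qed.

(** * Palindromic suffixes of the prefixes of [T] *)

Definition letter_rank (x : letter) : nat :=
  match x with La => 0 | Lb => 1 | Lc => 2 end.

Lemma letter_rank_inj : injective letter_rank.
Proof. by do 2!case. Qed.

(* The factor on the 0-based indices [i, ..., n - 1]. *)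
Definition trib_factor (i n : nat) : seq letter :=
  mkseq (fun k => trib (i + k)) (n - i).

(* Stated on [letter_rank] because equality on [letter] does not compute. *)
Definition pal (i n : nat) : bool :=
  let s := [seq letter_rank x | x <- trib_factor i n] in rev s == s.

Lemma palE i n : pal i n = (rev (trib_factor i n) == trib_factor i n).
Proof. by rewrite /pal -map_rev (inj_eq (inj_map letter_rank_inj)). Qed.

Lemma palP i n : reflect
  (forall x y, i <= x -> i <= y -> (x + y).+1 = i + n -> trib x = trib y)
  (pal i n).
Proof.
rewrite palE; have sz : size (trib_factor i n) = n - i by rewrite size_mkseq.
apply: (iffP eqP) => [E x y ix iy xy|H].
  have := congr1 (fun s => nth La s (x - i)) E.
  rewrite nth_rev sz ?nth_mkseq; try lia.
  by rewrite !subnKC // => <-; congr trib; lia.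
apply: (@eq_from_nth _ La) => [|k]; rewrite size_rev // sz => kn.
by rewrite nth_rev sz // !nth_mkseq; try lia; apply: H; lia.
Qed.

(** A pair counted by [b n] is determined by the start of its occurrence: the end [n] fixes the
    word, and counting occurrences up to the start recovers [p]. *)
Lemma count_palindrome_suffixes n : b n = count (pal ^~ n) (iota 0 n).
Proof.
pose f i := let s := trib_factor i n in
  (s, count (occurs_at s) (iota 1 i.+1)).
set r := filter (pal ^~ n) (iota 0 n).
have fr : uniq (map f r).
  rewrite map_inj_in_uniq ?filter_uniq ?iota_uniq // => i k.
  rewrite !mem_filter !mem_iota /= => /andP[_ i_n] /andP[_ k_n] [E _].
  by have := congr1 size E; rewrite !size_mkseq; lia.
rewrite -size_filter -/r -(size_map f) -(undup_id fr).
rewrite -(finmap.size_seq_fset tt).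
congr (size (finmap.enum_fset _)); apply/finmap.fsetP => -[s p].
rewrite finmap.seq_fsetE cardinality.in_fset_set;
  last exact: finite_palindrome_occurrences.
apply/idP/mapP => [|[i]].
  rewrite classical_sets.in_setE.
  move=> -[[/= s0 revs _] _ [i [/andP[i0 /eqP si] <-] E]].
  case: i i0 si E => // i _ si E.
  have {}E : size s = n - i by case: E => <-; rewrite addKn.
  have {}s0 : 0 < size s by move: s0; case: (s).
  have {}si : trib_factor i n = s by rewrite /trib_factor -E -subword_trib.
  exists i; last by rewrite /f si.
  by rewrite mem_filter mem_iota palE si revs eqxx; lia.
rewrite mem_filter mem_iota /= add0n palE => /andP[/eqP reve i_n] [-> ->].
have occ : occurs_at (trib_factor i n) i.+1.
  by rewrite /occurs_at size_mkseq subword_trib eqxx.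
have cnt : 0 < count (occurs_at (trib_factor i n)) (iota 1 i.+1).
  by rewrite -has_count; apply/hasP; exists i.+1; rewrite // mem_iota; lia.
rewrite classical_sets.in_setE; split=> /=.
- split=> //; last by exists i.+1.
  by move/(congr1 size); rewrite size_mkseq /=; lia.
- exact: cnt.
- exists i.+1; first by split.
  by rewrite size_mkseq; lia.
Qed.

(** * The pointwise recurrence for [b] *)

Lemma central_palindrome j x y :
  (x + y).+1 = size (central j) -> trib x = trib y.
Proof.
have /palP H : pal 0 (size (central j)).
  by rewrite palE /trib_factor subn0 -[mkseq _ _]central_trib rev_central.
by move=> E; apply: H.
Qed.

Lemma trib_shift j x :
  x < size (central j) -> trib (size (tau_pow j) + x) = trib x.
Proof.
move=> xj; have xj' : size (tau_pow j) + x < size (central j.+1).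
  by rewrite size_centralS ltn_add2l.
rewrite -(nth_mkseq La trib xj') -central_trib centralS nth_cat.
by rewrite ltnNge leq_addr /= addKn central_trib nth_mkseq.
Qed.

Lemma pal_shift j i n : size (tau_pow j) <= n <= size (central j.+1) ->
  pal (size (tau_pow j) + i) n = pal i (n - size (tau_pow j)).
Proof.
rewrite size_centralS => /andP[tn nL].
(* Here both factors are empty, hence palindromes. *)
case: (leqP n (size (tau_pow j) + i)) => [le|lt].
  have z a c : c <= a -> pal a c by move=> ca; apply/palP => x y; lia.
  by rewrite !z //; lia.
apply/palP/palP => H x y ix iy xy.
  by rewrite -(@trib_shift j x) -?(@trib_shift j y); try apply: H; lia.
have -> : x = size (tau_pow j) + (x - size (tau_pow j)) by lia.
have -> : y = size (tau_pow j) + (y - size (tau_pow j)) by lia.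
by rewrite !trib_shift; try apply: H; lia.
Qed.

Lemma pal_before_shift j i n :
  size (central j.+3) < n <= size (central j.+4) -> i < size (tau_pow j.+3) ->
  pal i n = (i == size (central j.+4) - n).
Proof.
move=> /andP[Ln nL] it; set i0 := _ - n.
have t0 := size_tau_pow_gt0 j.+3.
have sL := size_tau_pow_central j.+3.
have LE := size_centralS j.+3.
have pal0 : pal i0 n.
  by apply/palP => x y _ _ xy; apply: (@central_palindrome j.+4); lia.
suff lt_pal a c :
    a < c -> c < size (tau_pow j.+3) -> pal a n -> pal c n -> False.
  case: (ltngtP i i0) => [lt|gt|-> //]; apply/negP => palin.
    by apply: (lt_pal i i0) => //; lia.
  by apply: (lt_pal i0 i).
move=> ac ct /palP Ha /palP Hc.
(* The two reflections compose to a translation by [c - a], under which the kernel word reappears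
   earlier. The bound on [c] keeps the translated word at or after [a]; [n > |P (j+3)|] keeps the
   original inside the suffix starting at [c]. *)
suff: (size (tau_pow j.+3)).-1 <= (size (tau_pow j.+3)).-1 - (c - a) by lia.
apply: kernel_word_first => k kL.
rewrite (Hc ((size (tau_pow j.+3)).-1 + k)
            (c + n - (size (tau_pow j.+3) + k))); try lia.
by apply: Ha; lia.
Qed.

Lemma b_recurrence j n : size (central j.+3) < n <= size (central j.+4) ->
  b n = b (n - size (tau_pow j.+3)) + 1.
Proof.
move=> nI; have /andP[Ln nL] := nI.
have LE := size_centralS j.+3; have L3 := size_central_sub3 j.
rewrite !count_palindrome_suffixes.
have -> : iota 0 n = iota 0 (size (tau_pow j.+3) + (n - size (tau_pow j.+3))).
  by congr iota; lia.
rewrite iotaD count_cat addnC add0n -[X in iota X _]addn0 iotaDl.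
rewrite count_map; congr (_ + _).
  by apply: eq_count => i; apply: pal_shift; lia.
rewrite (@eq_in_count _ _ (pred1 (size (central j.+4) - n))) => [|i].
  by rewrite count_uniq_mem ?iota_uniq // mem_iota; lia.
by rewrite mem_iota add0n; apply: pal_before_shift.
Qed.

(** * Kernel numbers and the vector form *)

Lemma kernel_number_central j : kernel_number (j + 4) = (size (central j)).+2.
Proof.
rewrite addn4.
suff: [/\ kernel_number j.+4 = (size (central j)).+2,
              kernel_number j.+4.+1 = (size (central j.+1)).+2
            & kernel_number j.+4.+2 = (size (central j.+2)).+2] by case.
elim: j => [//|j [H0 H1 H2]]; split=> //.
have -> : kernel_number j.+4.+3 =
  kernel_number j.+4.+2 + kernel_number j.+4.+1 + kernel_number j.+4 - 1 by [].
rewrite H0 H1 H2 (size_centralS j.+2).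
(* This identity reconciles the kernel recurrence with [|P (j+3)| = |A (j+2)| + |P (j+2)|]. *)
have : size (tau_pow j.+2) = size (central j.+1) + size (central j) + 3.
  elim: j {H0 H1 H2} => [//|j IH].
  by rewrite size_tau_powSSS IH !size_centralS; lia.
lia.
Qed.

Lemma size_bvec i j : size (bvec i j) = j.+1 - i.
Proof. by rewrite size_map size_iota. Qed.

Lemma bvec_cat i j k : i <= j -> j <= k ->
  bvec i.+1 j ++ bvec j.+1 k = bvec i.+1 k.
Proof.
move=> ij jk; rewrite /bvec -map_cat /index_iota !subSS -{2}(subnKC ij) -iotaD.
by congr (map _ (iota _ _)); lia.
Qed.

Lemma vadd_nseq1 s : vadd s (nseq (size s) 1) = map succn s.
Proof. by rewrite /vadd; elim: s => [//|x s /= ->]; rewrite addn1. Qed.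

Theorem theorem7p1 :
  [/\ bvec 1 1 = [:: 1],
      bvec 2 3 = [:: 1; 2],
      bvec 4 7 = [:: 1; 2; 2; 3]
    & forall m : nat, 4 <= m ->
        let k := kernel_number in
        let lhs := bvec (k (m + 3) - 1) (k (m + 4) - 2) in
        let rhs := bvec (k m - 1) (k (m + 1) - 2)
                     ++ bvec (k (m + 1) - 1) (k (m + 2) - 2)
                     ++ bvec (k (m + 2) - 1) (k (m + 3) - 2) in
        [/\ size lhs = t2 (m + 1),
            size rhs = t2 (m + 1)
          & lhs = vadd rhs (nseq (t2 (m + 1)) 1)]].
Proof.
split; try by rewrite /bvec /= !count_palindrome_suffixes.
move=> m /subnK <-; move: (m - 4) => j k lhs rhs.
have -> : t2 (j + 4 + 1) = size (tau_pow j.+3).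
  by rewrite -t2_tau_pow; congr t2; lia.
have kE i : k (j + 4 + i) = (size (central (i + j))).+2.
  by rewrite -kernel_number_central; congr kernel_number; lia.
have lhsE : lhs = bvec (size (central j.+3)).+1 (size (central j.+4)).
  by rewrite /lhs !kE !subSS !subn0.
have L0 := size_centralS j; have L1 := size_centralS j.+1.
have L2 := size_centralS j.+2; have L3 := size_centralS j.+3.
have L4 := size_central_sub3 j.
(* The three windows are consecutive and join into one. *)
have rhsE : rhs = bvec (size (central j)).+1 (size (central j.+3)).
  rewrite /rhs -{1}[j + 4]addn0 !kE !subSS !subn0 add0n add1n add2n.
  by rewrite -[3 + j]/j.+3 !bvec_cat //; lia.
have size_rhs : size rhs = size (tau_pow j.+3) by rewrite rhsE size_bvec; lia.
split=> //; first by rewrite lhsE size_bvec; lia.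
rewrite -size_rhs vadd_nseq1 rhsE lhsE /bvec /index_iota.
have -> : (size (central j.+4)).+1 - (size (central j.+3)).+1 =
    size (tau_pow j.+3).
  by lia.
have -> : (size (central j.+3)).+1 - (size (central j)).+1 =
    size (tau_pow j.+3).
  by lia.
have step n : size (central j) < n <= size (central j.+3) ->
    b (size (tau_pow j.+3) + n) = (b n).+1.
  by move=> nI; rewrite (@b_recurrence j) ?addKn ?addn1 // L3; lia.
(* Since [|P (j+3)| = |A (j+3)| + |P j|], the left window is the right one shifted by
   [|A (j+3)|]. *)
rewrite {1}L4 -addnS iotaDl -!map_comp; apply/eq_in_map => n.
by rewrite mem_iota => nI; apply: step; rewrite L4 addnC -ltnS.
Qed.
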